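(* Let $n\ge1$. For any non-trivial (i.e. non-empty) narrow Young diagram $$\sigma=(\underbrace{2,\dots,2}_t,\underbrace{1,\dots,1}_b)\in\Omega_{n,n+1},$$ it holds that $\sigma\in\Omega^0_{n,n+1}$ and $$\lambda'_{(n+1)}(\sigma)=\Big(\underbrace{-\tfrac n2,\dots,-\tfrac n2}_t,\ \underbrace{-\tfrac n2-1,\dots,-\tfrac n2-1}_b,\ -\tfrac n2-2,\dots,-\tfrac n2-2\Big),$$ an $(n+1)$-tuple.
   Context: $\Sigma_{n,k}$ is the set of Young diagrams (partitions) with at most $n$ boxes in the first two columns together and depth (number of nonzero rows) at most $k$; $\Omega_{n,k}\subset\Sigma_{n,k}$ is the subset of narrow diagrams, i.e. those with at most two columns. Weights of $\mathfrak{sp}(2k,\mathbb{C})$ are $k$-tuples, in coordinates with respect to an orthogonal basis $\varepsilon_1,\dots,\varepsilon_k$ of $\mathfrak{h}^*$ in which the root system is $\Delta=\{\pm\varepsilon_i\pm\varepsilon_j\ (i<j),\ \pm2\varepsilon_i\}$ with simple roots $\varepsilon_i-\varepsilon_{i+1}$ ($i<k$), $2\varepsilon_k$; $\rho=(k,k-1,\dots,1)$ is the half-sum of positive roots and $\Delta_n^+=\{\varepsilon_i+\varepsilon_j:1\le i\le j\le k\}$ is the set of non-compact positive roots. For $\sigma\in\Sigma_{n,k}$ put $\sigma^\sharp=(-\sigma_k-\frac n2,\dots,-\sigma_1-\frac n2)$. For $\lambda=\sigma^\sharp$ let $\Psi_\lambda=\{\alpha\in\Delta:(\alpha,\lambda+\rho)=0\}$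 and let $\Gamma^k_\lambda$ be the set of $\alpha\in\Delta_n^+$ such that (i) $(\lambda+\rho,\alpha^\vee)\in\{1,2,3,\dots\}$, where $\alpha^\vee$ is the coroot, (ii) $\alpha$ is orthogonal to $\Psi_\lambda$, (iii) if $\Psi_\lambda$ contains a long root (one of $\pm2\varepsilon_i$), then $\alpha$ is short. Let $\Sigma^0_{n,k}=\{\sigma\in\Sigma_{n,k}:\Gamma^k_{\sigma^\sharp}\ne\emptyset\}$ and $\Omega^0_{n,k}=\Omega_{n,k}\cap\Sigma^0_{n,k}$. For $\sigma\in\Sigma^0_{n,k}$ the set $\Gamma^k_{\sigma^\sharp}$ has a unique minimum $\gamma$ in the usual partial order on roots ($\alpha\le\beta$ iff $\beta-\alpha$ is a sum of positive roots), and $\lambda'_{(k)}(\sigma)=(s_\gamma(\sigma^\sharp+\rho))^+-\rho$, where $s_\gamma$ is the root reflection and $\mu^+$ is the weakly decreasing rearrangement of the coordinates of $\mu$. *)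

(* Defs.v *)
From mathcomp Require Import all_boot all_order all_algebra.
From mathcomp Require Import boolp classical_sets.

Set Implicit Arguments.
Unset Strict Implicit.
Unset Printing Implicit Defensive.

Import Order.TTheory GRing.Theory Num.Theory.
Local Open Scope ring_scope.

(* A Young diagram is the sequence of its row lengths, without trailing
   zeros; its depth is the size of the sequence. *)
Definition young (s : seq nat) : bool := sorted geq s && all (ltn 0) s.

Definition column (s : seq nat) (j : nat) : nat := count (ltn j) s.

Definition Sigma (n k : nat) (s : seq nat) : bool :=
  [&& young s, (column s 0 + column s 1 <= n)%N & (size s <= k)%N].

Definition Omega (n k : nat) (s : seq nat) : bool :=
  Sigma n k s && all (geq 2) s.

(* Weights of sp(2k) in the coordinates eps_0, ..., eps_(k-1).  The roots, rho
   and the weights s^sharp all have rational coordinates, so the rational form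
   of the dual of the Cartan subalgebra is enough.  The basis is normalised to
   be orthonormal, which affects neither orthogonality nor pairings with
   coroots.  Indices start at 0. *)
Section Weights.
Variable k : nat.
Notation weight := 'rV[rat]_k.
Implicit Types (a b x : weight) (P : weight -> Prop).

Definition eps (i : 'I_k) : weight := delta_mx 0 i.

Definition dot x a : rat := \sum_(i < k) x 0 i * a 0 i.

Definition coroot a : weight := (2 / dot a a) *: a.

Definition reflection a x : weight := x - dot x (coroot a) *: a.

Definition short_root a : Prop :=
  exists i j : 'I_k, (i < j)%N /\
  exists e f : bool, a = (-1) ^+ e *: eps i + (-1) ^+ f *: eps j.

Definition long_root a : Prop :=
  exists (i : 'I_k) (e : bool), a = (-1) ^+ e *: (2 *: eps i).

Definition root_sys a : Prop := short_root a \/ long_root a.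

Definition simple_root a : Prop :=
  (exists i j : 'I_k, j = i.+1 :> nat /\ a = eps i - eps j) \/
  (exists i : 'I_k, i.+1 = k /\ a = 2 *: eps i).

(* Finite sums, possibly empty and possibly with repetitions. *)
Definition sum_of P x : Prop :=
  exists s : seq weight, (forall a, a \in s -> P a) /\ x = \sum_(a <- s) a.

Definition positive_root a : Prop := root_sys a /\ sum_of simple_root a.

Definition root_le a b : Prop := sum_of positive_root (b - a).

Definition noncompact_root a : Prop :=
  exists i j : 'I_k, (i <= j)%N /\ a = eps i + eps j.

Definition rho : weight := \row_(i < k) (k - i)%:R.

Definition Psi (lambda : weight) a : Prop :=
  root_sys a /\ dot a (lambda + rho) = 0.

Definition Gamma (lambda : weight) a : Prop :=
  [/\ noncompact_root a,
      exists m : nat, dot (lambda + rho) (coroot a) = m.+1%:R,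
      forall b, Psi lambda b -> dot a b = 0
    & (exists b, Psi lambda b /\ long_root b) -> short_root a].

Definition is_minimum P a : Prop := P a /\ forall b, P b -> root_le a b.

Definition decreasing x : weight :=
  \row_(i < k) nth 0 (sort >=%O [seq x 0 j | j <- enum 'I_k]) i.

End Weights.

Arguments rho {k}.

Definition sharp (n k : nat) (s : seq nat) : 'rV[rat]_k :=
  \row_(i < k) (- (nth 0%N s (rev_ord i))%:R - n%:R / 2).

Definition Sigma0 (n k : nat) (s : seq nat) : Prop :=
  Sigma n k s /\ exists a, Gamma (sharp n k s) a.

Definition Omega0 (n k : nat) (s : seq nat) : Prop :=
  Omega n k s /\ Sigma0 n k s.

(* The minimum is unique when it exists (minimum_unique below); the default
   value 0 of xget is only used when there is no minimum. *)
Definition min_Gamma (n k : nat) (s : seq nat) : 'rV[rat]_k :=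
  xget 0 (is_minimum (Gamma (sharp n k s))).

Definition lambda' (n k : nat) (s : seq nat) : 'rV[rat]_k :=
  decreasing (reflection (min_Gamma n k s) (sharp n k s + rho)) - rho.

Section Uniqueness.
Variable k : nat.
Implicit Types a b x : 'rV[rat]_k.

Lemma dotDl a b x : dot (a + b) x = dot a x + dot b x.
Proof. by rewrite -big_split; apply: eq_bigr => i _; rewrite mxE mulrDl. Qed.

Lemma dotZl (c : rat) a x : dot (c *: a) x = c * dot a x.
Proof. by rewrite /dot mulr_sumr; apply: eq_bigr => i _; rewrite mxE mulrA. Qed.

Lemma dotNl a x : dot (- a) x = - dot a x.
Proof. by rewrite -scaleN1r dotZl mulN1r. Qed.

Lemma dot0l x : dot 0 x = 0.
Proof. by rewrite /dot big1 // => i _; rewrite mxE mul0r. Qed.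

Lemma dot_eps (i : 'I_k) x : dot (eps i) x = x 0 i.
Proof.
rewrite /dot (bigD1 i) //= big1 => [|j ji]; rewrite !mxE ?eqxx ?mul1r ?addr0 //.
by rewrite (negbTE ji) mul0r.
Qed.

Lemma simple_root_rho a : simple_root a -> 0 < dot a rho.
Proof.
case=> [[i [j [ij ->]]]|[i [ik ->]]].
  rewrite dotDl dotNl !dot_eps !mxE subr_gt0 ltr_nat ij.
  by rewrite ltn_sub2l // -ij.
by rewrite dotZl dot_eps mxE mulr_gt0 // ltr0n subn_gt0.
Qed.

Lemma sum_of_rho (P : 'rV[rat]_k -> Prop) x :
  (forall a, P a -> 0 <= dot a rho) -> sum_of P x -> 0 <= dot x rho.
Proof.
move=> P0 [s [Ps ->]]; elim: s Ps => [|a s IHs] Ps.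
  by rewrite big_nil dot0l.
rewrite big_cons dotDl addr_ge0 //; first by apply/P0/Ps/mem_head.
by apply: IHs => b bs; apply: Ps; rewrite inE bs orbT.
Qed.

Lemma root_sys_neq0 a : root_sys a -> a != 0.
Proof.
case=> [[i [j [ij [e [f ->]]]]]|[i [e ->]]].
  apply/eqP => /rowP/(_ i); rewrite !mxE !eqxx /= -val_eqE (ltn_eqF ij).
  by rewrite mulr0 addr0 mulr1 => /eqP; rewrite signr_eq0.
apply/eqP => /rowP/(_ i); rewrite !mxE !eqxx /= mulr1 => /eqP.
by rewrite mulf_eq0 signr_eq0.
Qed.

Lemma positive_root_rho a : positive_root a -> 0 < dot a rho.
Proof.
move=> [/root_sys_neq0 a0 [s [sP aE]]]; move: a0; rewrite aE.
case: s sP {aE} => [|b s] sP; first by rewrite big_nil eqxx.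
rewrite big_cons dotDl => _; apply: ltr_pwDl.
  exact/simple_root_rho/sP/mem_head.
apply: (@sum_of_rho (@simple_root k)) => [c /simple_root_rho/ltW //|].
by exists s; split=> // c cs; apply: sP; rewrite inE cs orbT.
Qed.

Lemma root_le_anti a b : root_le a b -> root_le b a -> a = b.
Proof.
move=> [s [sP sE]] ba; apply/esym/eqP; rewrite -subr_eq0 sE.
case: s sP sE => [|c s] sP sE; first by rewrite big_nil.
have pos0 (d : 'rV[rat]_k) : positive_root d -> 0 <= dot d rho.
  by move=> dp; exact: ltW (positive_root_rho dp).
have c0 : 0 < dot c rho by exact/positive_root_rho/sP/mem_head.
have s0 : 0 <= dot (\sum_(d <- s) d) rho.
  by apply: (sum_of_rho pos0); exists s; split=> // d ds; apply: sP; rewrite inE ds orbT.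
have := sum_of_rho pos0 ba.
by rewrite -opprB sE dotNl oppr_ge0 big_cons dotDl leNgt ltr_pwDl.
Qed.

Lemma minimum_unique (P : 'rV[rat]_k -> Prop) a b :
  is_minimum P a -> is_minimum P b -> a = b.
Proof. by move=> [Pa aP] [Pb bP]; apply: root_le_anti; [exact: aP|exact: bP]. Qed.

Lemma min_GammaE (n : nat) (s : seq nat) a :
  is_minimum (Gamma (sharp n k s)) a -> min_Gamma n k s = a.
Proof. by move=> amin; apply: xget_unique => // b /minimum_unique; apply. Qed.

End Uniqueness.

(* Main.v *)
Require Import Defs.
From mathcomp Require Import all_boot all_order all_algebra.
From mathcomp Require Import zify ring lra.

Set Implicit Arguments.
Unset Strict Implicit.

Import Order.TTheory GRing.Theory Num.Theory.
Local Open Scope ring_scope.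

(** Write k = n+1 and x = sigma^sharp + rho.  Adding
    rho to a narrow weight spreads its coordinates out: with N = k+1 = n+2,

      x_i = N/2 - w_i,

    where w_0 < w_1 < ... lists the integers of [0, N] other than the two gaps
    p = n+1-t-b and q = n+2-t (sharp_rho_narrow).  The hypothesis on columns,
    2t+b <= n, says exactly that p+q > N.

    Two coordinates are opposite precisely when w_i + w_j = N, so the weight is
    understood through the involution v |-> N - v of [0, N].  Each coordinate
    whose mirror image N - w_i is again some w_j lies on a singular root, and
    Gamma cannot use it.  The coordinates left are those mirror to a gap,
    w_A = N-q and w_B = N-p; since p+q > N they exist, except that N-p is
    missing when it equals p.
    - If 2p <> N, doubled roots 2 eps_A and 2 eps_B are excluded: either N is
      odd and their pairings are not integral, or N/2 is some w_l and Psi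
      contains a long root.  Only eps_A + eps_B survives, and its pairing
      p+q-N is positive.
    - If 2p = N, only the index A is left, Psi has no long root, and 2 eps_A
      has the positive pairing q-p.
    So Gamma is always a singleton (Gamma_mem, Gamma_unique), and its element is
    its minimum.

    The reflection in eps_A + eps_B exchanges and negates two coordinates; on
    the w's it puts p at index A and q at index B.  The gaps p and q get filled,
    and N-q and N-p become the new gaps; in the case 2p = N the gap p = N-p
    stays and q is exchanged for N-q.  Sorting therefore yields the same kind of
    weight with gaps N-q = t and N-p = t+b+1 (decreasing_reflection);
    subtracting rho leaves -n/2 lowered by the number of gaps already passed,
    which is the asserted tuple. *)

(** * Sums of two coordinate vectors as roots *)

Lemma dotC k (x y : 'rV[rat]_k) : dot x y = dot y x.
Proof. by apply: eq_bigr => i _; rewrite mulrC. Qed.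

Lemma dot_root k (i j : 'I_k) (x : 'rV[rat]_k) :
  dot (eps i + eps j) x = x 0 i + x 0 j.
Proof. by rewrite dotDl !dot_eps. Qed.

Lemma dot_coroot k (i j : 'I_k) (x : 'rV[rat]_k) :
  dot x (coroot (eps i + eps j)) = if i == j then x 0 i else x 0 i + x 0 j.
Proof.
rewrite dotC dotZl !dot_root !mxE !eqxx /= [j == i]eq_sym.
by case: eqVneq => [<-|_] /=; field.
Qed.

Lemma root_eps_add k (i j : 'I_k) : root_sys (eps i + eps j).
Proof.
wlog lij : i j / (i <= j)%N => [W|].
  by case/orP: (leq_total i j) => [/W//|/W]; rewrite addrC.
case: (eqVneq i j) => [<-|nij].
  by right; exists i, false; rewrite expr0 scale1r scaler_nat mulr2n.
left; exists i, j; split; first by rewrite ltn_neqAle lij andbT.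
by exists false, false; rewrite !expr0 !scale1r.
Qed.

Lemma short_eps_add k (i j : 'I_k) : i != j -> short_root (eps i + eps j).
Proof.
move=> nij; case: (ltngtP i j) => [lij|lji|/val_inj/eqP]; last by rewrite (negbTE nij).
  by exists i, j; split=> //; exists false, false; rewrite !expr0 !scale1r.
by exists j, i; split=> //; exists false, false; rewrite !expr0 !scale1r addrC.
Qed.

Lemma noncompact_eps_add k (i j : 'I_k) : noncompact_root (eps i + eps j).
Proof.
by case/orP: (leq_total i j) => lij; [exists i, j|exists j, i; rewrite [RHS]addrC].
Qed.

(** A short root has a coordinate 1 or -1, whereas those of eps i + eps i are 2
    and 0. *)
Lemma double_eps_not_short k (i : 'I_k) : ~ short_root (eps i + eps i).
Proof.
case=> [a [c [ac [e [f aE]]]]]; have := congr1 (fun x : 'rV[rat]_k => x 0 a) aE.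
have := congr1 (fun x : 'rV[rat]_k => x 0 c) aE; rewrite !mxE !eqxx /=.
rewrite -![_ == c]val_eqE -![_ == a]val_eqE /= (ltn_eqF ac) (gtn_eqF ac).
by case: (a == i); case: (c == i); case: e {aE}; case: f => /=; rewrite ?expr0 ?expr1; lra.
Qed.

(** * Recognising the decreasing rearrangement *)

(** A strictly decreasing y has distinct entries, so if they all occur in x they
    exhaust the k entries of x; injectivity of x need not be checked. *)
Lemma decreasing_eq k (x y : 'rV[rat]_k) :
    (forall i j : 'I_k, (i < j)%N -> y 0 j < y 0 i) ->
    (forall i, exists j, x 0 j = y 0 i) ->
  decreasing x = y.
Proof.
move=> y_dec y_x; set X := [seq x 0 j | j <- enum 'I_k].
set Y := [seq y 0 j | j <- enum 'I_k].
have uY : uniq Y.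
  rewrite map_inj_uniq ?enum_uniq // => i j yij; apply/val_inj.
  by case: (ltngtP i j) => // /y_dec; rewrite yij ltxx.
have sYX : {subset Y <= X}.
  by move=> _ /mapP[i _ ->]; case: (y_x i) => j <-; rewrite map_f ?mem_enum.
have sz : (size X <= size Y)%N by rewrite !size_map.
have pXY : perm_eq X Y.
  have [_ eYX] := uniq_min_size uY sYX sz.
  by rewrite perm_sym uniq_perm // (leq_size_uniq uY).
have sY : sorted >=%O Y.
  apply/(sortedP 0) => i; rewrite size_map size_enum_ord => ik.
  pose i0 := Ordinal ik.
  rewrite !(nth_map i0) -?enumT ?size_enum_ord ?(ltnW ik) //.
  by apply/ltW/y_dec; rewrite -?enumT !nth_enum_ord // ltnW.
apply/rowP => i; rewrite mxE.
have -> : sort >=%O X = Y.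
  apply: (@sorted_eq _ (>=%O : rel rat)) => //.
  - exact: ge_trans.
  - exact: ge_anti.
  - exact/sort_sorted/ge_total.
  - by rewrite perm_sort.
by rewrite (nth_map i) ?size_enum_ord // nth_ord_enum.
Qed.

(** * Weights with two gaps *)

(** The increasing enumeration of the natural numbers other than p and q, for
    p < q: the inner bump skips p, and the outer one then skips q. *)
Definition skip2 p q i := bump q (bump p i).

(** The shift by half of k+1 centres the interval from 0 to k+1, so that mirror
    images in this interval give opposite coordinates. *)
Definition gapped k p q : 'rV[rat]_k := \row_i (k.+1%:R / 2 - (skip2 p q i)%:R).
Arguments gapped : clear implicits.

Lemma skip2_inj p q : injective (skip2 p q).
Proof. by move=> i j; rewrite /skip2 /bump; lia. Qed.

(** The k values taken on [0, k[ and the two gaps are all of [0, k+1]. *)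
Lemma skip2_surj k p q v : (p < q <= k.+1)%N -> (v <= k.+1)%N -> v != p -> v != q ->
  exists i : 'I_k, skip2 p q i = v.
Proof.
move=> pq vk vp vq; have ik : (unbump p (unbump q v) < k)%N by rewrite /unbump; lia.
by exists (Ordinal ik); rewrite /skip2 /= /bump /unbump; lia.
Qed.

Section Gapped.
Variables k p q : nat.
Hypothesis pq : (p < q <= k.+1)%N.
Hypothesis kpq : (k.+1 < p + q)%N.
Notation w := (skip2 p q).
Notation x := (gapped k p q).

Lemma skip2_neq i : w i != p /\ w i != q.
Proof. by rewrite /skip2 /bump; lia. Qed.

Lemma gapped_addE (i j : 'I_k) : x 0 i + x 0 j = k.+1%:R - (w i + w j)%:R.
Proof. by rewrite !mxE natrD; lra. Qed.

Lemma gapped_inj i j : x 0 i = x 0 j -> i = j.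
Proof.
rewrite !mxE => xij; apply/val_inj/(@skip2_inj p q).
by apply/eqP; rewrite -(eqr_nat rat); apply/eqP; lra.
Qed.

(** Singularity along eps i + eps j becomes a mirror condition on integers. *)
Lemma gapped_add_eq0 (i j : 'I_k) :
  (x 0 i + x 0 j == 0) = (w i + w j == k.+1)%N.
Proof. by rewrite gapped_addE subr_eq0 eqr_nat eq_sym. Qed.

(** The coordinates of the weight are distinct, so a root orthogonal to it is, up
    to sign, eps c + eps d for a mirror pair c, d (with c = d for a long root);
    an unpaired index is neither. *)
Lemma orth_gapped_coord a (i : 'I_k) :
    root_sys a -> dot a x = 0 -> (forall j : 'I_k, (w i + w j != k.+1)%N) ->
  a 0 i = 0.
Proof.
move=> ra ax iP.
have cancel (c d : 'I_k) (e f : bool) : dot ((-1) ^+ e *: eps c + (-1) ^+ f *: eps d) x = 0 ->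
    e != f -> c = d.
  rewrite dotDl !dotZl !dot_eps => H ef; apply: gapped_inj.
  by move: H ef; case: e; case: f => //=; rewrite ?expr0 ?expr1; lra.
have cancel2 (c d : 'I_k) (e : bool) : dot ((-1) ^+ e *: eps c + (-1) ^+ e *: eps d) x = 0 ->
    (w c + w d)%N = k.+1.
  rewrite -scalerDr dotZl dot_root => /eqP.
  by rewrite mulf_eq0 signr_eq0 gapped_add_eq0 => /eqP.
case: ra ax => [[c [d [cd [e [f ->]]]]]|[c [e ->]]].
  case: (eqVneq e f) => [-> /cancel2 wcd|ef /cancel/(_ ef) cdE]; last by move: cd; rewrite cdE ltnn.
  rewrite !mxE !eqxx /=.
  case: (eqVneq i c) => [ic|_]; first by have := iP d; rewrite ic wcd eqxx.
  case: (eqVneq i d) => [id|_]; first by have := iP c; rewrite id addnC wcd eqxx.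
  by rewrite !mulr0 addr0.
rewrite scaler_nat mulr2n scalerDr => /cancel2 wcc.
rewrite !mxE !eqxx /=; case: (eqVneq i c) => [ic|_].
  by have := iP c; rewrite ic wcc eqxx.
by rewrite mulr0 addr0.
Qed.

(** * The set Gamma is a singleton *)

Section Gamma.
Variable lambda : 'rV[rat]_k.
Hypothesis lambdaE : lambda + rho = x.

(** If index i had a mirror partner l, the root eps i + eps l would lie in Psi,
    yet two such sums sharing eps i have positive inner product.  So the mirror
    image of the value at i is one of the two gaps. *)
Lemma Gamma_unpaired (i j : 'I_k) : Gamma lambda (eps i + eps j) ->
  w i = (k.+1 - p)%N \/ w i = (k.+1 - q)%N.
Proof.
case=> _ _ orth _.
have unpaired (l : 'I_k) : (w i + w l != k.+1)%N.
  apply/eqP => wil.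
  have Pil : Psi lambda (eps i + eps l).
    split; first exact: root_eps_add.
    by rewrite lambdaE dot_root; apply/eqP; rewrite gapped_add_eq0 wil.
  have := orth _ Pil; rewrite dot_root !mxE !eqxx /=.
  by case: (i == l); case: (j == i); case: (j == l) => /=; lra.
have wk : (w i <= k.+1)%N by have := ltn_ord i; rewrite /skip2 /bump; lia.
case: (eqVneq (k.+1 - w i)%N p) => [|np]; first by lia.
case: (eqVneq (k.+1 - w i)%N q) => [|nq]; first by lia.
have vk : (k.+1 - w i <= k.+1)%N by lia.
by have [l wl] := skip2_surj pq vk np nq; have := unpaired l; rewrite wl; lia.
Qed.

(** Integrality of the pairing with a long root makes k+1 even.  If its half were
    a value and not a gap, it would give a long root of Psi and force the root
    to be short; and q is too large to be that half. *)
Lemma Gamma_double (i : 'I_k) : Gamma lambda (eps i + eps i) -> (p + p)%N = k.+1.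
Proof.
case=> _ [m]; rewrite lambdaE dot_coroot eqxx => xm _ short.
have wm : (k.+1 = 2 * (m.+1 + w i))%N.
  by apply/eqP; rewrite -(eqr_nat rat) natrM natrD -xm mxE; apply/eqP; lra.
case: (eqVneq (m.+1 + w i)%N p) => [|np]; first by lia.
have nq : (m.+1 + w i)%N != q by lia.
have vk : (m.+1 + w i <= k.+1)%N by lia.
have [l wl] := skip2_surj pq vk np nq.
case: (@double_eps_not_short k i); apply: short; exists (eps l + eps l).
split; last by exists l, false; rewrite expr0 scale1r scaler_nat mulr2n.
split; first exact: root_eps_add.
by rewrite lambdaE dot_root; apply/eqP; rewrite gapped_add_eq0; lia.
Qed.

(** B = A encodes the case in which Gamma consists of the long root 2 eps_A, so
    that eps A + eps B is its element in both cases. *)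
Variables A B : 'I_k.
Hypothesis wA : w A = (k.+1 - q)%N.
Hypothesis wB : if (p + p == k.+1)%N then B = A else w B = (k.+1 - p)%N.

(** The mirror images of the values at A and B are gaps, so no root of Psi
    involves either index.  The pairing is q - p for the long root and
    p + q - (k+1) for the short one.  A long root of Psi puts the half of k+1
    among the values, which rules out the long case. *)
Lemma Gamma_mem : Gamma lambda (eps A + eps B).
Proof.
have unpairedA (j : 'I_k) : (w A + w j != k.+1)%N by have := skip2_neq j; lia.
have unpairedB (j : 'I_k) : (w B + w j != k.+1)%N.
  by move: wB; case: eqP => [_ -> //|_ ->]; have := skip2_neq j; lia.
split.
- exact: noncompact_eps_add.
- rewrite lambdaE dot_coroot; move: wB; case: eqP => [pk ->|pk wBE].
    exists (q - p).-1; rewrite eqxx mxE wA prednK ?subn_gt0; last by lia.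
    by rewrite !natrB -?pk ?natrD; [lra|lia|lia].
  have -> : (A == B) = false by apply/eqP => AB; move: wBE; rewrite -AB; lia.
  exists (p + q - k.+1).-1; rewrite gapped_addE wA wBE prednK; last by lia.
  by rewrite -natrB; [congr (_%:R); lia|lia].
- move=> a [ra]; rewrite lambdaE dot_root => ax.
  by rewrite !(@orth_gapped_coord a) ?addr0.
case=> a [[ra]]; rewrite lambdaE => ax [l [e aE]].
have wl : (w l + w l)%N = k.+1.
  apply/eqP; rewrite -gapped_add_eq0 -dot_root.
  move/eqP: ax; rewrite aE dotZl mulf_eq0 signr_eq0 /=.
  by rewrite scaler_nat mulr2n.
have pk : (p + p)%N <> k.+1 by have := skip2_neq l; lia.
apply/short_eps_add/eqP => AB; move: wB; case: eqP => // _.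
by rewrite -AB; lia.
Qed.

(** Both indices of an element of Gamma lie in {A, B}, and Gamma_double decides
    whether they may coincide. *)
Lemma Gamma_unique a : Gamma lambda a -> a = eps A + eps B.
Proof.
move=> Ga; have [[i [j [_ aE]]] _ _ _] := Ga.
have Gij : Gamma lambda (eps i + eps j) by rewrite -aE.
have Gji : Gamma lambda (eps j + eps i) by rewrite addrC.
have eqA (l : 'I_k) : w l = (k.+1 - q)%N -> l = A.
  by rewrite -wA => /skip2_inj/val_inj.
have wi := Gamma_unpaired Gij; have wj := Gamma_unpaired Gji.
have avi := skip2_neq i; have avj := skip2_neq j.
rewrite aE; move: wB; case: eqP => [pk ->|pk wBE].
  have -> : i = A by apply: eqA; lia.
  by have -> : j = A by apply: eqA; lia.
have eqB (l : 'I_k) : w l = (k.+1 - p)%N -> l = B.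
  by rewrite -wBE => /skip2_inj/val_inj.
have nij : i <> j by move=> ij; apply: pk; move: Gij; rewrite ij => /Gamma_double.
case: wi wj => [/eqB iE|/eqA iE] [/eqB jE|/eqA jE]; rewrite ?iE ?jE //.
- by case: nij; rewrite iE jE.
- by rewrite addrC.
- by case: nij; rewrite iE jE.
Qed.

Lemma Gamma_minimum : is_minimum (Gamma lambda) (eps A + eps B).
Proof.
split=> [|a /Gamma_unique ->]; first exact: Gamma_mem.
by exists [::]; rewrite big_nil subrr.
Qed.

End Gamma.

(** * The reflected weight *)

(** Each value v of the new enumeration has to occur after the reflection.  The
    old gap q now sits at B, and the old gap p sits at A unless it is its own
    mirror image and stays a gap; any other v was already a value, at an index
    which the reflection does not move. *)
Lemma decreasing_reflection (A B : 'I_k) :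
    w A = (k.+1 - q)%N ->
    (if (p + p == k.+1)%N then B = A else w B = (k.+1 - p)%N) ->
  decreasing (reflection (eps A + eps B) x) = gapped k (k.+1 - q) (k.+1 - p).
Proof.
move=> wA wB; apply: decreasing_eq => [i j ij|i].
  by rewrite !mxE ltrD2l ltrN2 ltr_nat /skip2 /bump; lia.
have [] : skip2 (k.+1 - q) (k.+1 - p) i != (k.+1 - q)%N /\
          skip2 (k.+1 - q) (k.+1 - p) i != (k.+1 - p)%N.
  by rewrite /skip2 /bump; lia.
have : (skip2 (k.+1 - q) (k.+1 - p) i <= k.+1)%N.
  by have := ltn_ord i; rewrite /skip2 /bump; lia.
rewrite [gapped k (k.+1 - q) (k.+1 - p) 0 i]mxE; move: (skip2 (k.+1 - q) _ i) => v.
move=> vk vA vB.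
have reflE l : reflection (eps A + eps B) x 0 l =
    x 0 l - (if A == B then x 0 A else x 0 A + x 0 B) * ((l == A)%:R + (l == B)%:R).
  by rewrite /reflection dot_coroot !mxE.
have xv (l : 'I_k) : (w l + v)%N = k.+1 -> k.+1%:R / 2 - v%:R = - x 0 l.
  by move=> wlv; rewrite mxE -wlv natrD; lra.
case: (eqVneq v q) => [vq|nvq].
  exists B; rewrite reflE eqxx (xv A) ?wA; last by lia.
  move: wB; case: eqP => [_ ->|pk wBE]; first by rewrite eqxx /=; lra.
  have /negbTE nAB : A != B by apply/eqP => AB; move: wBE; rewrite -AB; lia.
  by rewrite nAB [B == A]eq_sym nAB /=; lra.
case: (eqVneq v p) => [vp|nvp].
  exists A; rewrite reflE eqxx; move: wB; case: eqP => [|pk wBE]; first by lia.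
  have /negbTE nAB : A != B by apply/eqP => AB; move: wBE; rewrite -AB; lia.
  by rewrite nAB (xv B) ?wBE /=; [lra|lia].
have [l wl] := skip2_surj pq vk nvp nvq.
have lA : l != A by apply/eqP => lA; move: wl vA; rewrite lA wA => ->; rewrite eqxx.
have lB : l != B.
  apply/eqP => lB; move: wB; case: eqP => [_ BA|pk wBE].
    by move: lA; rewrite lB BA eqxx.
  by move: vB; rewrite -wl lB wBE eqxx.
by exists l; rewrite reflE (negbTE lA) (negbTE lB) mxE wl /=; lra.
Qed.

Lemma Gamma_indices : exists A B : 'I_k, w A = (k.+1 - q)%N /\
  if (p + p == k.+1)%N then B = A else w B = (k.+1 - p)%N.
Proof.
have [||||A wA] := @skip2_surj k p q (k.+1 - q)%N; rewrite ?leq_subr //; try by lia.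
exists A; case: eqP => [_|pk]; first by exists A.
by have [||||B wB] := @skip2_surj k p q (k.+1 - p)%N; [lia..|exists B].
Qed.

End Gapped.

(** * Narrow diagrams *)

(** The coordinate i is (n+2)/2 - (i + s), where s is the row of length at most 2
    with index n - i.  As i grows these row lengths pass from 0 to 1 at
    i = n+1-t-b and from 1 to 2 at i = n+1-t, and each increase skips one
    integer. *)
Lemma sharp_rho_narrow n t b : (2 * t + b <= n)%N ->
  sharp n n.+1 (nseq t 2%N ++ nseq b 1%N) + rho
  = gapped n.+1 (n.+1 - (t + b)) (n.+2 - t).
Proof.
move=> tb; apply/rowP => i; rewrite !mxE nth_cat !nth_nseq size_nseq.
have il := ltn_ord i.
set s := (if _ then _ else _); have -> : skip2 (n.+1 - (t + b)) (n.+2 - t) i = (i + s)%N.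
  by rewrite /s /skip2 /bump /=; do 2?case: ifP; lia.
by rewrite natrB ?(ltnW il) // natrD -[n.+2%:R]natr1 -[n.+1%:R]natr1; lra.
Qed.

Theorem lemma4p2 (n t b : nat) (hn : (1 <= n)%N)
    (hne : nseq t 2%N ++ nseq b 1%N <> [::])
    (hO : Omega n n.+1 (nseq t 2%N ++ nseq b 1%N)) :
  Omega0 n n.+1 (nseq t 2%N ++ nseq b 1%N) /\
  lambda' n n.+1 (nseq t 2%N ++ nseq b 1%N) =
    \row_(i < n.+1)
      (if (i < t)%N then - (n%:R / 2)
       else if (i < t + b)%N then - (n%:R / 2) - 1
       else - (n%:R / 2) - 2) :> 'rV[rat]_n.+1.
Proof.
have hS : Sigma n n.+1 (nseq t 2%N ++ nseq b 1%N) by case/andP: hO.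
have tb : (2 * t + b <= n)%N.
  by case/and3P: hS => _; rewrite /column !count_cat !count_nseq /=; lia.
have xE := sharp_rho_narrow tb.
set p := (n.+1 - (t + b))%N in xE; set q := (n.+2 - t)%N in xE.
have pq : (p < q <= n.+2)%N by rewrite /p /q; lia.
have kpq : (n.+2 < p + q)%N by rewrite /p /q; lia.
have [A [B [wA wB]]] := Gamma_indices pq kpq.
have Gmin := Gamma_minimum pq kpq xE wA wB.
split; first by split=> //; split=> //; exists (eps A + eps B); case: Gmin.
rewrite /lambda' (min_GammaE Gmin) xE (decreasing_reflection pq kpq wA wB).
have -> : (n.+2 - q)%N = t by rewrite /q; lia.
have -> : (n.+2 - p)%N = (t + b).+1 by rewrite /p; lia.
apply/rowP => i; rewrite !mxE natrB ?(ltnW (ltn_ord i)) //.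
have -> : skip2 t (t + b).+1 i =
    (i + if (i < t)%N then 0 else if (i < t + b)%N then 1 else 2)%N.
  by rewrite /skip2 /bump; do 2?case: ifP; lia.
rewrite natrD -[n.+2%:R]natr1 -[n.+1%:R]natr1.
by case: ifP => _; [|case: ifP => _]; lra.
Qed.
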